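(* If $\Sigma$ is a (regular right-side) optimum basis of a finite convex geometry $\langle G,\phi\rangle$, then, for every binary implication $(x\to Y)\in\Sigma$ (with $x\in G$), $Y=\mathrm{Ex}\big(\phi(\{x\})\setminus\{x\}\big)$.
   Context: A closure system $\langle G,\phi\rangle$ is a set $G$ with a closure operator $\phi:2^G\to 2^G$ (extensive, monotone, idempotent); $X\subseteq G$ is closed if $\phi(X)=X$. It is a convex geometry if $\phi(\emptyset)=\emptyset$ and the anti-exchange axiom holds: for all $x\neq y$ in $G$ and all closed $X\subseteq G$, if $x\in\phi(X\cup\{y\})$ and $x\notin X$, then $y\notin\phi(X\cup\{x\})$. It is finite if $G$ is finite. In a convex geometry $\phi(\{x\})\setminus\{x\}$ is closed for every $x\in G$. For a closed set $X$, $\mathrm{Ex}(X)=\{x\in X: x\notin\phi(X\setminus\{x\})\}$ is the set of extreme points of $X$. An implication $X\to Y$ is an ordered pair of nonempty disjoint subsets of $G$; it is binary if $|X|=1$, and $\{x\}\to Y$ is written $x\to Y$. A set $\Sigma$ of implications defines the closure system whose closed sets are the $Z\subseteq G$ such that for all $(X\to Y)\in\Sigma$, $X\subseteq Z$ implies $Y\subseteq Z$. A basis of $\langle G,\phi\rangle$ is a set of implications defining it. For a basis $\Sigma=\{X_1\to Y_1,\dots,X_k\to Y_k\}$, its size is $s(\Sigma)=|X_1|+\dots+|X_k|+|Y_1|+\dots+|Y_k|$ and its $R$-size is $s_R(\Sigma)=|Y_1|+\dots+|Y_k|$. The basis $\Sigma$ is optimum if $s(\Sigma)\le s(\Sigma^*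 )$ for every basis $\Sigma^*$ of the same closure system, and right-side optimum if $s_R(\Sigma)\le s_R(\Sigma^* )$ for every such basis $\Sigma^*$. The basis $\Sigma$ is regular if $\phi(B)=\phi(\{x\})\setminus\{x\}$ for every binary implication $(x\to B)\in\Sigma$. A regular right-side optimum basis is one that is both regular and right-side optimum. It is known that every optimum basis of a convex geometry is regular. *)

(* Defs.v *)
From mathcomp Require Import all_boot.

Set Implicit Arguments.
Unset Strict Implicit.
Unset Printing Implicit Defensive.

Section ClosureSystems.

(* The finite ground set G is the whole of the finite type. *)
Variable G : finType.
Implicit Types (phi : {set G} -> {set G}) (X Y Z : {set G}) (x y : G).

Record closure_operator phi : Prop := ClosureOperator {
  closure_extensive : forall X, X \subset phi X;
  closure_monotone : forall X Y, X \subset Y -> phi X \subset phi Y;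
  closure_idempotent : forall X, phi (phi X) = phi X
}.

Definition closed_set phi X : Prop := phi X = X.

Record convex_geometry phi : Prop := ConvexGeometry {
  convex_geometry_closure : closure_operator phi;
  convex_geometry_set0 : phi set0 = set0;
  anti_exchange : forall x y X, x != y -> closed_set phi X ->
    x \in phi (X :|: [set y]) -> x \notin X -> y \notin phi (X :|: [set x])
}.

Definition Ex phi X : {set G} := [set x in X | x \notin phi (X :\ x)].

(* The pair (X, Y) encodes the implication X -> Y. *)
Definition is_implication (i : {set G} * {set G}) : Prop :=
  [/\ i.1 != set0, i.2 != set0 & [disjoint i.1 & i.2]].

Implicit Types Sigma : {set {set G} * {set G}}.

Definition respects Sigma Z : Prop :=
  forall i, i \in Sigma -> i.1 \subset Z -> i.2 \subset Z.

Definition basis phi Sigma : Prop :=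
  (forall i, i \in Sigma -> is_implication i) /\
  (forall Z, closed_set phi Z <-> respects Sigma Z).

Definition basis_size Sigma : nat := \sum_(i in Sigma) (#|i.1| + #|i.2|).

Definition basis_rsize Sigma : nat := \sum_(i in Sigma) #|i.2|.

Definition optimum_basis phi Sigma : Prop :=
  basis phi Sigma /\
  forall Sigma', basis phi Sigma' -> basis_size Sigma <= basis_size Sigma'.

Definition right_optimum_basis phi Sigma : Prop :=
  basis phi Sigma /\
  forall Sigma', basis phi Sigma' -> basis_rsize Sigma <= basis_rsize Sigma'.

Definition regular_basis phi Sigma : Prop :=
  basis phi Sigma /\
  forall x Y, ([set x], Y) \in Sigma -> phi Y = phi [set x] :\ x.

End ClosureSystems.

(* Main.v *)
Require Import Defs.
From mathcomp Require Import all_boot.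

(** Write [H] for [phi [set x] :\ x].  In a finite convex geometry every closed
    set is the closure of its extreme points ([closure_Ex]), so [H] is closed
    ([closed_closure1D1]) and [Ex phi H] is the least generating set of [H].

    Replacing the implication [x -> Y] by [x -> Ex phi H] gives another basis
    ([basis_replaceEx]): since [x] is not in [H], neither implication takes part
    in deriving [H] from [Ex phi H], so the rest of the basis already recovers
    [Y].  If [phi Y = H], then [Y] contains [Ex phi H]; were it larger, this
    exchange would lower both sizes.

    A regular basis has [phi Y = H] by definition.  For an optimum basis this
    comes from a second exchange ([basis_merge]): another implication [A -> B]
    with [x] in [A] and [A] inside [phi [set x]] could be absorbed into
    [x -> Y :|: B], which saves at least [#|A|].  Hence there is none, so
    [x |: phi Y] respects the basis; it is closed and therefore contains
    [phi [set x]] ([optimum_regular]). *)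

Set Implicit Arguments.
Unset Strict Implicit.
Unset Printing Implicit Defensive.

Lemma sum_setU1_le (T : finType) (f : T -> nat) (a : T) (A : {set T}) :
  \sum_(i in a |: A) f i <= f a + \sum_(i in A) f i.
Proof.
have [aA|aNA] := boolP (a \in A); last by rewrite big_setU1.
by rewrite (setUidPr _) ?sub1set // leq_addl.
Qed.

Section Closure.

Variables (G : finType) (phi : {set G} -> {set G}).
Hypothesis phi_closure : closure_operator phi.
Implicit Types (X Y Z : {set G}) (x : G).

Lemma closure_sub X Z : closed_set phi Z -> X \subset Z -> phi X \subset Z.
Proof.
by move=> clZ XZ; rewrite -clZ; apply: (closure_monotone phi_closure).
Qed.

Lemma mem_closure1 x : x \in phi [set x].
Proof. by rewrite -sub1set (closure_extensive phi_closure). Qed.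

(** An extreme point of [X] cannot be recovered from the rest of [X], so no
    generating set of [X] can omit it. *)
Lemma Ex_sub_generator X Y : phi Y = X -> Ex phi X \subset Y.
Proof.
move=> genY; apply/subsetP => e; rewrite inE => /andP[eX eNX].
apply: contraR eNX => eNY; move: eX; rewrite -{1}genY.
apply: (subsetP (closure_monotone phi_closure _)).
by rewrite subsetD1 eNY andbT -genY (closure_extensive phi_closure).
Qed.

End Closure.

Section ConvexGeometry.

Variables (G : finType) (phi : {set G} -> {set G}).
Hypothesis phi_convex : convex_geometry phi.
Let phi_closure : closure_operator phi := convex_geometry_closure phi_convex.
Implicit Types (X Y Z A B : {set G}) (x : G).
Implicit Types Sigma : {set {set G} * {set G}}.

(** The finite Krein-Milman property.  If [phi (Ex phi X)] were smaller than
    [X], take a maximal closed set [M] that contains it and is proper in [X].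
    Adding any missing point to [M] generates [X], so by anti-exchange [M]
    misses only one point [p]; then [X :\ p = M] is closed, which makes [p] an
    extreme point outside [M]. *)
Lemma closure_Ex X : closed_set phi X -> phi (Ex phi X) = X.
Proof.
move=> clX.
have subX : phi (Ex phi X) \subset X.
  by apply: closure_sub => //; apply/subsetP => e; rewrite inE => /andP[].
apply/eqP; apply: contraT => neX.
pose P M := [&& phi M == M, phi (Ex phi X) \subset M & M \proper X].
have /maxset_exists[M /maxsetP[/and3P[/eqP clM EM MX] maxM] _] :
    P (phi (Ex phi X)).
  by rewrite /P (closure_idempotent phi_closure) eqxx subxx properEneq neX.
have genX q : q \in X -> q \notin M -> phi (M :|: [set q]) = X.
  move=> qX qNM; set N := phi _.
  have NX : N \subset X.
    by apply: closure_sub => //; rewrite subUset sub1set qX proper_sub.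
  have MqN : M :|: [set q] \subset N by apply: (closure_extensive phi_closure).
  have MN : M \subset N by apply: subset_trans MqN; apply: subsetUl.
  apply/eqP; apply: contraT => neNX.
  have PN : P N.
    rewrite /P /N (closure_idempotent phi_closure) eqxx /=.
    by rewrite properEneq neNX NX (subset_trans EM).
  have eNM := maxM _ PN MN.
  have: q \in N by apply: (subsetP MqN); rewrite !inE eqxx orbT.
  by rewrite eNM (negPf qNM).
have [p pX pNM] := (properP MX).2.
have eM : X :\ p = M.
  apply/eqP; rewrite eqEsubset subsetD1 (proper_sub MX) pNM !andbT.
  apply/subsetP => q /setD1P[qp qX]; apply: contraT => qNM.
  have := anti_exchange phi_convex qp clM.
  by rewrite !genX // pX => /(_ qX qNM).
have: p \in Ex phi X by rewrite inE pX eM clM.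
move=> /(subsetP (closure_extensive phi_closure _)) /(subsetP EM).
by rewrite (negPf pNM).
Qed.

(** Any point of [phi [set x]] other than [x] is recovered from [x], so [x] is
    the only candidate for an extreme point; there must be one, as the closure
    of the empty set is empty. *)
Lemma closed_closure1D1 x : closed_set phi (phi [set x] :\ x).
Proof.
have clx : closed_set phi (phi [set x]).
  by apply: (closure_idempotent phi_closure).
have xx := mem_closure1 phi_closure x.
have [xE|xNE] := boolP (x \in Ex phi (phi [set x])).
  move: xE; rewrite inE => /andP[_ xN].
  apply/eqP; rewrite eqEsubset (closure_extensive phi_closure) andbT.
  by rewrite subsetD1 xN andbT closure_sub // subsetDl.
have subE : Ex phi (phi [set x]) \subset [set x] by apply: Ex_sub_generator.
have E0 : Ex phi (phi [set x]) = set0.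
  by apply/eqP; move: subE; rewrite subset1 => /orP[/eqP eE|//];
     rewrite eE set11 in xNE.
move: xx; rewrite -(closure_Ex clx) E0 (convex_geometry_set0 phi_convex).
by rewrite inE.
Qed.

Lemma basis_closed_sub Sigma A B Z :
  basis phi Sigma -> (A, B) \in Sigma -> closed_set phi Z ->
  A \subset Z -> B \subset Z.
Proof. by move=> [_ bS] ABS /bS /(_ _ ABS). Qed.

Lemma basis_binary_sub Sigma x Y :
  basis phi Sigma -> ([set x], Y) \in Sigma -> Y \subset phi [set x] :\ x.
Proof.
move=> bS xYS; have [_ _ /=] := bS.1 _ xYS.
rewrite disjoints1 => xNY; rewrite subsetD1 xNY andbT.
apply: (basis_closed_sub bS xYS); first exact: (closure_idempotent phi_closure).
exact: (closure_extensive phi_closure).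
Qed.

Lemma basis_replaceEx Sigma x Y :
  basis phi Sigma -> ([set x], Y) \in Sigma ->
  basis phi (([set x], Ex phi (phi [set x] :\ x)) |: Sigma :\ ([set x], Y)).
Proof.
move=> bS xYS; set H := phi [set x] :\ x.
have clH : closed_set phi H by apply: closed_closure1D1.
have YH : Y \subset H by apply: basis_binary_sub bS xYS.
have EH : Ex phi H \subset H by apply: Ex_sub_generator.
split=> [i|Z].
  case/setU1P=> [->|/setD1P[_ /bS.1//]].
  split=> /=; first by apply/set0Pn; exists x; rewrite set11.
    apply/eqP => E0; have [_ /= /set0Pn[y yY] _] := bS.1 _ xYS.
    move/(subsetP YH): yY; rewrite -(closure_Ex clH) E0.
    by rewrite (convex_geometry_set0 phi_convex) inE.
  by rewrite disjoints1; apply: contraTN (set11 x) => /(subsetP EH);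
     rewrite !inE eqxx.
split=> [clZ i|rZ].
  case/setU1P=> [-> /= xZ|/setD1P[_ /(bS.2 Z).1]]; last exact.
  apply: subset_trans EH _; apply: subset_trans (subsetDl _ _) _.
  exact: closure_sub.
apply/bS.2 => i iS iZ; have [ei|ni] := eqVneq i ([set x], Y); last first.
  by apply: rZ; rewrite // !inE ni iS orbT.
rewrite {}ei /= {i iS} in iZ *.
(* [x -> Y] is vacuous on [Z :&: H], which therefore respects all of [Sigma]. *)
have clZH : closed_set phi (Z :&: H).
  apply/bS.2 => i iS; rewrite !subsetI => /andP[jZ jH].
  rewrite ((bS.2 H).1 clH i) // andbT; apply: rZ => //.
  rewrite !inE iS andbT; apply/orP; right; apply/eqP => ei.
  by move: jH; rewrite ei sub1set !inE eqxx.
have EZ : Ex phi H \subset Z.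
  by have := rZ ([set x], Ex phi H); apply=> //; apply: setU11.
have HZ : H \subset Z :&: H.
  by rewrite -{1}(closure_Ex clH) closure_sub // subsetI EZ.
by apply: subset_trans YH (subset_trans HZ (subsetIl _ _)).
Qed.

(** Every closed set containing [x] contains [A], hence [B], so the conclusion
    [B] may be moved over to the premise [[set x]], contained in [A]. *)
Lemma basis_merge Sigma x A B Y :
  basis phi Sigma -> ([set x], Y) \in Sigma -> (A, B) \in Sigma ->
  x \in A -> A \subset phi [set x] ->
  basis phi (([set x], Y :|: B) |: Sigma :\ ([set x], Y) :\ (A, B)).
Proof.
move=> bS xYS ABS xA Ax.
have [x0 Y0 xY] := bS.1 _ xYS; have [_ _ AB] := bS.1 _ ABS.
have xNB : x \notin B by rewrite (disjointFr AB xA).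
split=> [i|Z].
  case/setU1P=> [->|/setD1P[_ /setD1P[_ /bS.1//]]]; split=> //=.
    by rewrite setU_eq0 negb_and (Y0 : Y != set0).
  by move: xY; rewrite /= !disjoints1 inE negb_or xNB => ->.
split=> [clZ i|rZ].
  case/setU1P=> [-> /= xZ|/setD1P[_ /setD1P[_ /(bS.2 Z).1]]]; last exact.
  rewrite subUset (basis_closed_sub bS xYS) //= (basis_closed_sub bS ABS) //.
  by apply: subset_trans Ax _; apply: closure_sub.
have rx : x \in Z -> Y :|: B \subset Z.
  by rewrite -sub1set => xZ; apply: (rZ ([set x], Y :|: B)) => //; apply: setU11.
apply/bS.2 => i iS iZ.
have [ei|ni] := eqVneq i ([set x], Y).
  by move: iZ; rewrite ei sub1set => /rx; rewrite subUset => /andP[].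
have [ei|mi] := eqVneq i (A, B).
  move: iZ; rewrite ei => /subsetP/(_ x xA)/rx.
  by rewrite subUset => /andP[].
by apply: rZ; rewrite // !inE ni mi iS orbT.
Qed.

(** Merging saves at least [#|A|], and [A] is nonempty as it contains [x].  The
    case [A = [set x]] is included, so an optimum basis has at most one binary
    implication from each point. *)
Lemma optimum_premise_uniq Sigma x A B Y :
  optimum_basis phi Sigma -> ([set x], Y) \in Sigma -> (A, B) \in Sigma ->
  x \in A -> A \subset phi [set x] -> (A, B) = ([set x], Y).
Proof.
move=> [bS optS] xYS ABS xA Ax; apply/eqP; apply: contraT => neq.
have ABS' : (A, B) \in Sigma :\ ([set x], Y) by rewrite !inE neq ABS.
have := optS _ (basis_merge bS xYS ABS xA Ax).
rewrite {1}/basis_size (big_setD1 _ xYS) (big_setD1 _ ABS') /=.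
move=> /leq_trans/(_ (sum_setU1_le _ _ _)) /=.
rewrite addnA leq_add2r cards1 -addnA leq_add2l.
move=> /leq_trans/(_ (leq_card_setU Y B)).
rewrite leq_add2l -{2}[#|B|]add0n leq_add2r leqn0 cards_eq0 => /eqP A0.
by rewrite A0 inE in xA.
Qed.

Lemma optimum_regular Sigma :
  optimum_basis phi Sigma -> regular_basis phi Sigma.
Proof.
move=> optS; have bS := optS.1; split=> // x Y xYS.
have YH := basis_binary_sub bS xYS.
apply/eqP; rewrite eqEsubset closure_sub ?subDset //=; last first.
  exact: closed_closure1D1.
have clxY : closed_set phi (x |: phi Y).
  apply/bS.2 => -[A B] ABS /= AxY.
  have [xA|xNA] := boolP (x \in A).
    have Ax : A \subset phi [set x].
      apply: subset_trans AxY _; rewrite subUset sub1set mem_closure1 //=.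
      apply: (closure_sub phi_closure).
        exact: (closure_idempotent phi_closure).
      by apply: subset_trans YH (subsetDl _ _).
    have [_ ->] := optimum_premise_uniq optS xYS ABS xA Ax.
    by rewrite subsetU // (closure_extensive phi_closure) orbT.
  have AY : A \subset phi Y.
    apply/subsetP => a aA; have /setU1P[ax|//] := subsetP AxY a aA.
    by rewrite -ax aA in xNA.
  apply: (subset_trans _ (subsetUr [set x] (phi Y))).
  by apply: (basis_closed_sub bS ABS) AY; apply: (closure_idempotent phi_closure).
by apply: closure_sub => //; rewrite sub1set setU11.
Qed.

End ConvexGeometry.

Theorem lemma9 (G : finType) (phi : {set G} -> {set G})
    (Sigma : {set {set G} * {set G}}) (x : G) (Y : {set G}) :
  convex_geometry phi ->
  (optimum_basis phi Sigma \/
   (regular_basis phi Sigma /\ right_optimum_basis phi Sigma)) ->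
  ([set x], Y) \in Sigma ->
  Y = Ex phi (phi [set x] :\ x).
Proof.
move=> phi_convex opt xYS.
have [bS genY] : regular_basis phi Sigma.
  by case: opt => [|[]] //; apply: optimum_regular.
have EY := Ex_sub_generator (convex_geometry_closure phi_convex) (genY _ _ xYS).
have bS' := basis_replaceEx phi_convex bS xYS.
apply/eqP; rewrite eq_sym eqEcard EY /=.
case: opt => [[_ /(_ _ bS')]|[_ [_ /(_ _ bS')]]].
  rewrite {1}/basis_size (big_setD1 _ xYS) /=.
  move=> /leq_trans/(_ (sum_setU1_le _ _ _)) /=.
  by rewrite leq_add2r leq_add2l.
rewrite {1}/basis_rsize (big_setD1 _ xYS) /=.
move=> /leq_trans/(_ (sum_setU1_le _ _ _)) /=.
by rewrite leq_add2r.
Qed.
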